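(* Let $\mathcal{L}$ be a finite bounded Cohen--Macaulay poset. If the chain polynomial of $\mathcal{L}$ has only real roots, then the chain polynomials of the pyramid $\mathrm{Pyr}(\mathcal{L})$ and of the prism $\mathrm{Prism}(\mathcal{L})$ over $\mathcal{L}$ also have only real roots.
   Context: For a finite poset $\mathcal{L}$, the chain polynomial is $p_{\mathcal{L}}(x) = \sum_{k \ge 0} c_k(\mathcal{L}) x^k$, where $c_k(\mathcal{L})$ is the number of $k$-element chains of $\mathcal{L}$. A poset is bounded if it has a minimum element $\hat{0}$ and a maximum element $\hat{1}$. It is Cohen--Macaulay if its order complex (the simplicial complex of all chains of $\mathcal{L}$) is Cohen--Macaulay over the field $\mathbb{Q}$. Let $\mathcal{L}_1$ be the $2$-element chain and $\mathcal{L}_2 = \mathcal{L}_1 \times \mathcal{L}_1$ (products of posets carry the componentwise order). For a bounded finite poset $\mathcal{L}$, the pyramid over $\mathcal{L}$ is $\mathrm{Pyr}(\mathcal{L}) = \mathcal{L} \times \mathcal{L}_1$, and the prism $\mathrm{Prism}(\mathcal{L})$ is the poset obtained by adding a minimum element to $(\mathcal{L} \setminus \{\hat{0}\}) \times (\mathcal{L}_2 \setminus \{\hat{0}\})$. *)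

(* Defs.v *)
From HB Require Import structures.
From mathcomp Require Import all_boot all_order all_algebra.
From mathcomp Require Import reals complex.
Set Implicit Arguments.
Unset Strict Implicit.
Unset Printing Implicit Defensive.
Import Order.TTheory GRing.Theory Num.Theory.
Local Open Scope ring_scope.

Definition is_chain d (L : finPOrderType d) (A : {set L}) : bool :=
  [forall x in A, forall y in A, (x >=< y)%O].

Definition nb_chains d (L : finPOrderType d) (k : nat) : nat :=
  #|[set A : {set L} | is_chain A & #|A| == k]|.

Definition chain_poly (R : nzRingType) d (L : finPOrderType d) : {poly R} :=
  \sum_(0 <= k < #|L|.+1) (nb_chains L k)%:R *: 'X^k.

Definition only_real_roots (R : realType) (p : {poly R}) : Prop :=
  forall z : R[i], root (map_poly (real_complex R) p) z -> complex.Im z = 0.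

(* A simplicial complex on the finite vertex set V is given by its set of
   faces, the empty face included. The vertices of each face are ordered by
   enum_rank, and faces are graded by cardinality: a face of cardinality k
   has dimension k - 1. *)

Definition order_complex d (L : finPOrderType d) : {set {set L}} :=
  [set A | is_chain A].

Section ReducedHomology.

Variables (F : fieldType) (V : finType).
Implicit Types (K : {set {set V}}) (c : {ffun {set V} -> F}).

Definition is_simplicial_chain K (k : nat) c : Prop :=
  forall A, c A != 0 -> A \in K /\ #|A| = k.

(* The linear map with A |-> \sum_(v in A) (-1)^(position of v in A) (A :\ v);
   below is the resulting coefficient of B in the boundary of c. The boundary
   of a vertex is the empty face, whence reduced homology. *)
Definition boundary c : {ffun {set V} -> F} :=
  [ffun B : {set V} => \sum_(v | v \notin B)
     (-1) ^+ #|[set w in B | (enum_rank w < enum_rank v)%N]| * c (v |: B)].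

(* The vanishing of the reduced homology of K over F in degree k - 1. *)
Definition reduced_homology_vanishes K (k : nat) : Prop :=
  forall c, is_simplicial_chain K k c -> boundary c = 0 ->
  exists2 b, is_simplicial_chain K k.+1 b & boundary b = c.

Definition link K (A : {set V}) : {set {set V}} :=
  [set B in K | [disjoint A & B] && (A :|: B \in K)].

(* The dimension of K plus one. *)
Definition max_face_card K : nat := (\max_(A in K) #|A|)%N.

Definition cohen_macaulay_complex K : Prop :=
  forall A, A \in K -> forall k, (k < max_face_card (link K A))%N ->
  reduced_homology_vanishes (link K A) k.

End ReducedHomology.

Definition cohen_macaulay d (L : finPOrderType d) : Prop :=
  cohen_macaulay_complex rat (order_complex L).

Definition nonbot d (L : finBPOrderType d) : Type := {x : L | x != \bot%O}.

HB.instance Definition _ d (L : finBPOrderType d) := SubFinite.on (nonbot L).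
HB.instance Definition _ d (L : finBPOrderType d) :=
  [SubChoice_isSubPOrder of nonbot L by <: with d].

Definition add_bot (T : Type) : Type := option T.

Section AddBot.

Variables (d : Order.disp_t) (T : finPOrderType d).

Definition add_bot_le (x y : add_bot T) : bool :=
  match x, y with
  | None, _ => true
  | Some _, None => false
  | Some a, Some b => (a <= b)%O
  end.

Fact add_bot_le_refl : reflexive add_bot_le.
Proof. by case=> /=. Qed.

Fact add_bot_le_anti : antisymmetric add_bot_le.
Proof. by move=> [a|] [b|] //= /le_anti ->. Qed.

Fact add_bot_le_trans : transitive add_bot_le.
Proof. by move=> [b|] [a|] [c|] //=; apply: le_trans. Qed.

HB.instance Definition _ := Finite.on (add_bot T).
HB.instance Definition _ := Order.Le_isPOrder.Build d (add_bot T)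
  add_bot_le_refl add_bot_le_anti add_bot_le_trans.

End AddBot.

(* T1 *p T2 is the product with the componentwise order, and bool carries the
   order false < true. *)
Notation L1 := bool.
Notation L2 := (L1 *p L1)%type.

Notation Pyr L := (L *p L1)%type.
Notation Prism L := (add_bot (nonbot L *p nonbot L2)%type).

(* Main.v *)
(** Recording the maximum of a chain gives p_P = 1 + \sum_x X g_x, where g_x is
    the chain polynomial of the elements below x and g_x = 1 + \sum_(y < x) X g_y.
    If Q consists of n minimal elements and one element above all of them,
    induction along this recurrence yields
      p_(P x Q) = p_P + n X (1 + X) p_P',
    with n = 1 for the pyramid and n = 2 for the prism, where P is L without its
    minimum. If p_P is real-rooted and divisible by 1 + X (which holds when P has
    a minimum or a maximum), the right-hand side is real-rooted: the logarithmic
    derivative of a real-rooted polynomial has imaginary part of sign opposite to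
    that of z, and the factor 1 + X absorbs the negative summand of
    1/(z (1 + z)) = 1/z - 1/(1 + z). *)

Require Import Defs.
From mathcomp Require Import all_boot all_order all_algebra.
From mathcomp Require Import reals complex.
From mathcomp Require Import ring.

Set Implicit Arguments.
Unset Strict Implicit.
Unset Printing Implicit Defensive.
Import Order.TTheory GRing.Theory Num.Theory.
Local Open Scope ring_scope.

(** * Chains and their greatest elements *)

Section Chains.
Variables (d : Order.disp_t) (P : finPOrderType d).
Implicit Types (S A : {set P}) (x y : P).

Lemma is_chainP A :
  reflect {in A &, forall x y, (x >=< y)%O} (is_chain A).
Proof.
apply: (iffP forall_inP) => [h x y xA yA | h x xA].
  by have /forall_inP := h x xA; apply.
by apply/forall_inP => y; apply: h.
Qed.

Lemma is_chain_sub A S : A \subset S -> is_chain S -> is_chain A.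
Proof.
move=> /subsetP sAS /is_chainP h; apply/is_chainP => x y /sAS xS /sAS yS.
exact: h.
Qed.

Lemma is_chain0 : is_chain (set0 : {set P}).
Proof. by apply/is_chainP => x y; rewrite inE. Qed.

Lemma is_chain_setU1 x A :
  {in A, forall y, (x >=< y)%O} -> is_chain (x |: A) = is_chain A.
Proof.
move=> xA; apply/idP/idP => [|/is_chainP hA].
  exact: is_chain_sub (subsetUr _ _).
apply/is_chainP => y z /setU1P [-> | yA] /setU1P [-> | zA].
- exact: comparablexx.
- exact: xA.
- by rewrite comparable_sym xA.
- exact: hA.
Qed.

Definition is_top x A := (x \in A) && [forall z in A, z <= x]%O.

Lemma is_top_uniq x y A : is_top x A -> is_top y A -> x = y.
Proof.
move=> /andP[xA /forall_inP hx] /andP[yA /forall_inP hy].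
by apply/le_anti; rewrite hx // hy.
Qed.

(** An element of [A] with the most elements below it is the top: anything of [A] above it has the
    same down-set, hence equals it. *)
Lemma chain_has_top A : is_chain A -> A != set0 -> exists x, is_top x A.
Proof.
move=> /is_chainP cA /set0Pn [x0 x0A].
pose rank x := #|[set z | (z <= x)%O]|.
have [x xA xmax] := @arg_maxnP _ x0 (fun x => x \in A) rank x0A.
exists x; rewrite /is_top xA /=.
apply/forall_inP => z zA; have /orP [// | le_xz] := cA z x zA xA.
rewrite le_eqVlt; apply/orP; left; rewrite eq_sym eq_le le_xz /=.
have sub : [set w | (w <= x)%O] \subset [set w | (w <= z)%O].
  by apply/subsetP => w; rewrite !inE => /le_trans; apply.
have := xmax z zA; rewrite /rank => le_zx.
have /eqP E : [set w | (w <= x)%O] == [set w | (w <= z)%O] by rewrite eqEcard sub.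
by have := lexx z; rewrite -[(z <= z)%O](in_set (fun w => w <= z)%O) -E inE.
Qed.

End Chains.

(** * Chain polynomials of subsets: cones and the recurrence *)

Section ChainPolynomial.
Variables (R : comNzRingType) (d : Order.disp_t) (P : finPOrderType d).
Implicit Types (S A : {set P}) (x y : P).

(** Relative to a subset, so that the recurrence can pass to down-sets without changing the type. *)
Definition chain_poly_in S : {poly R} :=
  \sum_(A : {set P} | is_chain A && (A \subset S)) 'X^#|A|.

Lemma chain_polyE : chain_poly R P = chain_poly_in setT.
Proof.
rewrite /chain_poly /chain_poly_in big_mkord.
have cardlt A : (#|A| < #|P|.+1)%N by rewrite ltnS max_card.
rewrite [RHS](partition_big (fun A => Ordinal (cardlt A)) predT) //=.
apply: eq_bigr => k _; rewrite /nb_chains.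
rewrite -sum1_card natr_sum scaler_suml; apply: eq_big => [A | A].
  by rewrite inE subsetT andbT -val_eqE.
by rewrite inE => /andP [_ /eqP ->]; rewrite scale1r.
Qed.

(** Inserting [x] is a bijection from the chains in [S] to those through [x]; it raises the
    cardinality by one. *)
Lemma sum_chains_through x S :
  x \notin S -> {in S, forall y, (x >=< y)%O} ->
  \sum_(A : {set P} | [&& is_chain A, A \subset x |: S & x \in A]) 'X^#|A|
  = 'X * chain_poly_in S.
Proof.
move=> xS xcmp; rewrite mulr_sumr.
rewrite (reindex_onto (fun A => x |: A) (fun A => A :\ x)) /=; last first.
  by move=> A /and3P [_ _ xA]; rewrite setD1K.
apply: eq_big => [A | A /andP [_ /eqP AE]].
  rewrite setU11 andbT; apply/idP/idP => [/andP [/andP [cA sA] /eqP AE] | ].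
    rewrite (is_chain_sub (subsetUr _ _) cA) /=; apply/subsetP => y yA.
    have := subsetP sA y; rewrite !inE yA orbT => /(_ isT) /orP [/eqP yx|//].
    by move: yA; rewrite -AE yx !inE eqxx.
  move=> /andP [cA /subsetP sA].
  rewrite is_chain_setU1 ?cA; last by move=> y /sA; apply: xcmp.
  rewrite setUS /=; last exact/subsetP.
  by rewrite setU1K //; apply: contra xS; apply: sA.
by rewrite cardsU1 -{1}AE !inE eqxx exprS.
Qed.

Lemma chain_poly_in_cone x S :
  x \notin S -> {in S, forall y, (x >=< y)%O} ->
  chain_poly_in (x |: S) = (1 + 'X) * chain_poly_in S.
Proof.
move=> xS xcmp; rewrite mulrDl mul1r -(sum_chains_through xS xcmp).
rewrite addrC /chain_poly_in (bigID (fun A => x \in A)) /=; congr (_ + _).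
  by apply: eq_bigl => A; rewrite andbA.
apply: eq_bigl => A; rewrite -andbA; congr (_ && _).
apply/andP/subsetP => [[/subsetP sA xA] y yA | sA].
  by have := sA y yA; case/setU1P => // yx; rewrite -yx yA in xA.
split; last by apply: contra xS; apply: sA.
by apply/subsetP => y /sA; apply: setU1r.
Qed.

(** Each nonempty chain is counted at its unique top [y]; the rest of it is a chain strictly below
    [y]. *)
Lemma chain_poly_in_rec S :
  chain_poly_in S =
  1 + \sum_(y in S) 'X * chain_poly_in [set z in S | z < y]%O.
Proof.
rewrite /chain_poly_in (bigD1 set0) /=; last by rewrite is_chain0 sub0set.
rewrite cards0 expr0; congr (_ + _).
under [RHS]eq_bigr => y yS.
  rewrite -(sum_chains_through (x := y)); last 2 first.
  - by rewrite inE ltxx andbF.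
  - by move=> z; rewrite inE => /andP[_ /ltW]; rewrite comparable_sym /(_ >=< _)%O => ->.
  over.
rewrite (exchange_big_dep
  (fun A => (is_chain A && (A \subset S)) && (A != set0))) /=; last first.
  move=> y A yS /and3P[-> sA yA] /=; apply/andP; split; last by apply/set0Pn; exists y.
  apply: subset_trans sA _; apply/subsetP => z /setU1P [-> // |]; rewrite inE.
  by case/andP.
apply: eq_bigr => A /andP[/andP[cA sA] A0].
have [x xtop] := chain_has_top cA A0; have /andP[xA /forall_inP xmax] := xtop.
rewrite (big_pred1 x) // => y; rewrite cA /=.
apply/idP/eqP => [/and3P[yS /subsetP sAy yA] | ->].
  apply: (is_top_uniq _ xtop); rewrite /is_top yA; apply/forall_inP => z /sAy.
  by case/setU1P => [-> // | ]; rewrite inE => /andP[_ /ltW].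
rewrite (subsetP sA) //= xA andbT; apply/subsetP => z zA.
by rewrite !inE lt_neqAle (subsetP sA) // xmax // andbT orbN.
Qed.

End ChainPolynomial.

(** * Transport along order embeddings *)

Lemma chain_poly_in_imset (R : comNzRingType) d d' (P : finPOrderType d)
    (Q : finPOrderType d') (f : P -> Q) (S : {set P}) :
  {mono f : x y / (x <= y)%O} ->
  chain_poly_in R (f @: S) = chain_poly_in R S.
Proof.
move=> fmono; have finj : injective f by exact: inc_inj.
have fcmp x y : (f x >=< f y)%O = (x >=< y)%O.
  by rewrite /(_ >=< _)%O !fmono.
rewrite /chain_poly_in (reindex_onto (fun A : {set P} => f @: A)
  (fun B : {set Q} => f @^-1: B)) /=.
  apply: eq_big => [A | A _]; last by rewrite card_imset.
  have -> : f @^-1: (f @: A) = A by apply/setP => x; rewrite inE mem_imset.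
  rewrite eqxx andbT; congr (_ && _).
    apply/is_chainP/is_chainP => [h x y xA yA | h _ _ /imsetP[x xA ->] /imsetP[y yA ->]].
      by have := h _ _ (imset_f f xA) (imset_f f yA); rewrite fcmp.
    by have := h _ _ xA yA; rewrite fcmp.
  apply/subsetP/subsetP => [h x xA | h _ /imsetP[x xA ->]].
    by have := h _ (imset_f f xA); rewrite mem_imset.
  by rewrite imset_f // h.
move=> B /andP[_ /subsetP sB]; apply/setP => y.
apply/imsetP/idP => [[x] | yB]; first by rewrite inE => fx ->.
by have /imsetP[x xS yx] := sB y yB; exists x => //; rewrite inE -yx.
Qed.

(** Here [Q] is a copy of [P] with one further point [t], comparable to everything; this covers
    adjoining a minimum. *)
Lemma chain_poly_cone (R : comNzRingType) d d' (P : finPOrderType d)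
    (Q : finPOrderType d') (f : P -> Q) (t : Q) :
  {mono f : x y / (x <= y)%O} -> (forall q, q >=< t)%O ->
  (forall q, (q == t) = (q \notin f @: setT)) ->
  chain_poly R Q = (1 + 'X) * chain_poly R P.
Proof.
move=> fmono tcmp tE; rewrite !chain_polyE.
have -> : [set: Q] = t |: f @: setT.
  by apply/setP => q; rewrite !inE tE orbC orbN.
rewrite chain_poly_in_cone ?chain_poly_in_imset -?tE // => q _.
by rewrite comparable_sym.
Qed.

(** * Product with a poset of minimal elements under one top *)

Section ProductWithCone.
Variables (R : comNzRingType) (d d' : Order.disp_t).
Variables (P : finPOrderType d) (Q : finPOrderType d') (t : Q).
(** The elements other than [t] form an antichain below [t]; [a] below is their number. *)
Hypothesis ltQ : forall u v : Q, (u < v)%O = (u != t) && (v == t).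

Local Notation PQ := (P *p Q)%type.
Local Notation g x := (chain_poly_in R [set z : P | z < x]%O).
Local Notation G x q := (chain_poly_in R [set z : PQ | z < ((x, q) : PQ)]%O).
Local Notation a := (#|Q|.-1)%:R.

Let lt_ind (T : P -> Prop) :
  (forall x, (forall y, (y < x)%O -> T y) -> T x) -> forall x, T x.
Proof.
move=> h x; have [n] := ubnP #|[set z | z < x]%O|.
elim: n x => // n IH x /ltnSE le_n; apply: h => y yx; apply: IH.
apply: leq_trans le_n; apply: proper_card; apply/properP; split.
  by apply/subsetP => z; rewrite !inE => /lt_trans; apply.
by exists y; rewrite !inE ?ltxx.
Qed.

Let below_rec d1 (T : finPOrderType d1) (x : T) :
  chain_poly_in R [set z | z < x]%O =
  1 + \sum_(y | (y < x)%O) 'X * chain_poly_in R [set z | z < y]%O.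
Proof.
rewrite chain_poly_in_rec; congr (_ + _); apply: eq_big => [y|y].
  by rewrite inE.
rewrite inE => yx; congr (_ * chain_poly_in _ _); apply/setP => z.
by rewrite !inE andbC; case: (boolP (z < y)%O) => // /lt_trans ->.
Qed.

Let below_deriv x :
  (g x)^`() = \sum_(y | (y < x)%O) (g y + 'X * (g y)^`()).
Proof.
rewrite {1}below_rec derivD derivC add0r raddf_sum /=.
by apply: eq_bigr => y _; rewrite derivM derivX mul1r.
Qed.

Let leQ (u v : Q) : (u <= v)%O = (u == v) || (u != t) && (v == t).
Proof. by rewrite le_eqVlt ltQ. Qed.

Let below_pair x q (F : P -> Q -> {poly R}) :
  \sum_(z : PQ | (z < ((x, q) : PQ))%O) F z.1 z.2 =
  \sum_(y | (y < x)%O) \sum_(r | (r <= q)%O) F y r + \sum_(r | (r < q)%O) F x r.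
Proof.
rewrite (eq_bigl (fun z : PQ => predT z.1 && (z < ((x, q) : PQ))%O)) //.
rewrite -(pair_big_dep predT (fun y r => ((y, r) : PQ) < ((x, q) : PQ))%O) /=.
rewrite (bigID (fun y => (y < x)%O)) /=; congr (_ + _).
  apply: eq_bigr => y yx; apply: eq_bigl => r.
  by rewrite preorder.Order.ProdOrder.lt_pair yx (ltW yx) /= orb_idr // => /ltW.
rewrite (bigD1 x) ?ltxx //= [X in _ + X]big1 ?addr0.
  by apply: eq_bigl => r; rewrite preorder.Order.ProdOrder.lt_pair ltxx lexx.
move=> y /andP[nyx ynx]; apply: big_pred0 => r.
by rewrite preorder.Order.ProdOrder.lt_pair (negPf nyx) [(y <= x)%O]le_eqVlt (negPf nyx) (negPf ynx).
Qed.

(** For minimal [q], the pairs below [(x, q)] are the [(y, q)] with [y < x], a copy of the down-set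
    of [x]. *)
Let below_min x q : q != t -> G x q = g x.
Proof.
move=> qt; elim/lt_ind: x => x IH; rewrite below_rec [RHS]below_rec.
rewrite (below_pair x q (fun y r => 'X * G y r)); congr (_ + _).
rewrite [X in _ + X]big_pred0 ?addr0; last by move=> r; rewrite ltQ (negPf qt) andbF.
apply: eq_bigr => y yx; rewrite (big_pred1 q) ?IH // => r.
by rewrite leQ (negPf qt) andbF orbF.
Qed.

Let sum_fibre x :
  \sum_q 'X * G x q = 'X * (a * g x + G x t).
Proof.
rewrite (bigD1 t) //= (eq_bigr (fun=> 'X * g x)).
  rewrite sumr_const (eq_card (B := predC1 t)) // cardC1.
  by rewrite addrC mulrDr -mulrnAr mulr_natl.
by move=> q qt; rewrite below_min.
Qed.

(** The left side times ['X] counts the chains with top in the fibre over [x]. The last factor on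
    the right is the derivative of ['X * g x], so that summing over [x] produces the derivative of
    the chain polynomial. *)
Let below_top x :
  a * g x + G x t = g x + a * (1 + 'X) * (g x + 'X * (g x)^`()).
Proof.
elim/lt_ind: x => x IH; rewrite [G x t]below_rec.
rewrite (below_pair x t (fun y r => 'X * G y r)).
(* The full fibres over [y < x], evaluated by induction and summed by the recurrence and its
   derivative. *)
have -> : \sum_(y | (y < x)%O) \sum_(r | (r <= t)%O) 'X * G y r =
  (g x - 1) + a * 'X * (1 + 'X) * (g x)^`().
  rewrite below_deriv {1}below_rec [1 + _]addrC addrK mulr_sumr -big_split /=.
  apply: eq_bigr => y yx; rewrite (eq_bigl predT) ?sum_fibre ?IH //; first by ring.
  by move=> r; rewrite leQ eqxx andbT orbN.
(* What remains is the fibre over [x] without its top: [a] terms, each equal to ['X * g x]. *)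
rewrite (eq_bigl (predC1 t)); last by move=> r; rewrite ltQ eqxx andbT.
rewrite (eq_bigr (fun=> 'X * g x)); last by move=> r rt; rewrite below_min.
by rewrite sumr_const cardC1 -[_ *+ _]mulr_natl; ring.
Qed.

Lemma chain_poly_prod_cone :
  chain_poly R PQ = chain_poly R P + a * 'X * (1 + 'X) * (chain_poly R P)^`().
Proof.
have top_rec d1 (T : finPOrderType d1) :
  chain_poly R T = 1 + \sum_(y : T) 'X * chain_poly_in R [set z | z < y]%O.
  rewrite chain_polyE chain_poly_in_rec; congr (_ + _).
  apply: eq_big => [y|y _]; first by rewrite inE.
  by congr (_ * chain_poly_in _ _); apply/setP => z; rewrite !inE.
rewrite !top_rec derivD derivC add0r raddf_sum /= -addrA; congr (_ + _).
rewrite mulr_sumr -big_split /=.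
rewrite -(pair_bigA _ (fun x q => 'X * G x q)) /=.
apply: eq_bigr => x _; rewrite sum_fibre below_top derivM derivX; ring.
Qed.

End ProductWithCone.

(** * Real-rootedness through the logarithmic derivative *)

Section RealRoots.
Variable R : realType.
Implicit Types (z w s : R[i]) (rs : seq R[i]) (p q : {poly R}).

Let ImD z w : complex.Im (z + w) = complex.Im z + complex.Im w.
Proof. by case: z w => [? ?] [? ?]. Qed.

Let ImMn z n : complex.Im (z *+ n) = complex.Im z *+ n.
Proof. by elim: n => // n IH; rewrite !mulrS ImD IH. Qed.

(** For real [s], the imaginary part of [(z - s)^-1] is that of [z], negated and divided by the
    squared modulus of [z - s]. *)
Lemma Im_inv_sub_lt0 z s :
  complex.Im z != 0 -> complex.Im s = 0 -> complex.Im z * complex.Im (z - s)^-1 < 0.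
Proof.
case: z s => [x y] [r s'] /= y0 ->; rewrite oppr0 addr0 mulrN oppr_lt0 mulrA.
apply: divr_gt0; first by rewrite -expr2 exprn_even_gt0.
by rewrite ltr_wpDl ?sqr_ge0 // exprn_even_gt0.
Qed.

(** The logarithmic derivative is the sum of the [(z - s)^-1], each with imaginary part of the sign
    opposite to that of [z]. *)
Lemma Im_log_deriv_le0 z rs :
  complex.Im z != 0 -> {in rs, forall s, complex.Im s = 0} ->
  let T := \prod_(s <- rs) ('X - s%:P) in
  complex.Im z * complex.Im (T^`().[z] / T.[z]) <= 0.
Proof.
move=> z0; elim: rs => [|s rs IH] rs_real /=.
  by rewrite big_nil derivC horner0 mul0r mulr0.
have {IH} := IH (fun u u_rs => rs_real u (mem_behead (s := s :: rs) u_rs)).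
rewrite big_cons; set T := \prod_(_ <- rs) _ => IH.
have s_real : complex.Im s = 0 by rewrite rs_real ?mem_head.
have zs : z - s != 0 by apply: contraNneq z0 => /subr0_eq ->; rewrite s_real.
(* If [T] vanishes at [z], the quotient is 0 by the convention that 0 has inverse 0. *)
have [Tz|Tz] := eqVneq T.[z] 0.
  by rewrite hornerM Tz mulr0 invr0 mulr0 mulr0.
have -> : (('X - s%:P) * T)^`().[z] / (('X - s%:P) * T).[z]
   = (z - s)^-1 + T^`().[z] / T.[z].
  rewrite derivM derivXsubC !hornerE /=; field; by rewrite Tz zs.
by rewrite ImD mulrDr -(addr0 0) lerD // ltW // Im_inv_sub_lt0.
Qed.

Lemma only_real_roots_dvd p q : q %| p -> only_real_roots p -> only_real_roots q.
Proof.
move=> /(dvdp_trans _) qp hp z zq; apply: hp; move: zq.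
rewrite -!dvdp_XsubCl => /dvdp_trans; apply.
by rewrite dvdp_map qp.
Qed.

Lemma only_real_roots_XD1M q :
  only_real_roots q -> only_real_roots ((1 + 'X) * q).
Proof.
move=> q_real z; rewrite rmorphM rootM => /orP[|/q_real //].
rewrite rmorphD rmorph1 /= map_polyX rootE !hornerE addrC addr_eq0 => /eqP ->.
by rewrite /= oppr0.
Qed.

(* At a nonreal root z, division by z (1 + z) q(z) gives
   1/z + n/(1 + z) + (n + 1) q'(z)/q(z) = 0, whereas all three terms have
   imaginary parts of sign opposite to that of z. *)
Lemma only_real_roots_chain_op n q (p := (1 + 'X) * q) :
  only_real_roots p ->
  only_real_roots (p + n.+1%:R * 'X * (1 + 'X) * p^`()).
Proof.
move=> p_real z; rewrite rootE => /eqP zroot; apply/eqP; apply: contraT => z0.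
have q_real : only_real_roots q by apply: only_real_roots_dvd p_real; exact: dvdp_mull.
set Q := map_poly (real_complex R) q.
have Qz : Q.[z] != 0 by apply: contra z0 => /q_real ->.
have zn0 : z != 0 by apply: contraNneq z0 => ->.
have Im1 : complex.Im (- 1 : R[i]) = 0 by rewrite /= oppr0.
have z1 : 1 + z != 0.
  by apply: contraNneq z0 => /eqP; rewrite addrC addr_eq0 => /eqP ->; rewrite Im1.
have eq0 : z^-1 + (1 + z)^-1 *+ n + (Q^`().[z] / Q.[z]) *+ n.+1 = 0.
  have pE : p + n.+1%:R * 'X * (1 + 'X) * p^`() =
      (1 + 'X) * (q + n.+1%:R * 'X * (q + (1 + 'X) * q^`())).
    by rewrite /p derivM derivD derivC derivX; ring.
  move: zroot; rewrite pE !(rmorphD, rmorphM, rmorph1, rmorph_nat) /=.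
  rewrite map_polyX -deriv_map -/Q !hornerE /= -polyC_natr hornerC.
  move=> /eqP; rewrite mulf_eq0 (negPf z1) /= => /eqP NE.
  (* Clearing denominators gives the second factor of [pE] at [z], since
     [(1 + z) + n z = 1 + (n + 1) z]. *)
  apply: (mulfI (mulf_neq0 (mulf_neq0 zn0 z1) Qz)); rewrite mulr0 -{}[RHS]NE.
  rewrite -[(1 + z)^-1 *+ n]mulr_natl -[_ *+ n.+1]mulr_natl -natr1; field.
  by rewrite zn0 z1 Qz.
have : complex.Im z * complex.Im
   (z^-1 + (1 + z)^-1 *+ n + (Q^`().[z] / Q.[z]) *+ n.+1) < 0.
  rewrite !ImD !ImMn !mulrDr !mulrnAr -(addr0 0) ltr_leD //.
    rewrite -(addr0 0) ltr_leD //; first by rewrite -[z in z^-1]subr0 Im_inv_sub_lt0.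
    by rewrite mulrn_wle0 // addrC -[1]opprK ltW // Im_inv_sub_lt0.
  (* Over the complex numbers [Q] splits, its roots being real by [q_real]; the leading coefficient
     cancels in the quotient. *)
  apply: mulrn_wle0; have [rs QE] := closed_field_poly_normal Q.
  have lcQ : lead_coef Q != 0.
    by apply: contraNneq Qz => lc0; rewrite QE lc0 scale0r horner0.
  rewrite QE derivZ !hornerZ -mulf_div divff // mul1r.
  apply: Im_log_deriv_le0 => //.
  move=> s s_rs; apply: q_real; rewrite -/Q QE rootZ //.
  by rewrite root_prod_XsubC.
by rewrite eq0 /= mulr0 ltxx.
Qed.

End RealRoots.

(** * Pyramids and prisms *)

Lemma card_nonbot_L2 : #|{: nonbot L2}| = 3.
Proof. by rewrite card_sig (eq_card (B := predC1 \bot%O)) // cardC1 card_prod card_bool. Qed.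

Theorem theorem1p4 (R : realType) (d : Order.disp_t) (L : finTBPOrderType d) :
  cohen_macaulay L ->
  only_real_roots (chain_poly R L) ->
  only_real_roots (chain_poly R (Pyr L)) /\
  only_real_roots (chain_poly R (Prism L)).
Proof.
move=> _ L_real.
have LE : chain_poly R L = (1 + 'X) * chain_poly R (nonbot L).
  apply: (@chain_poly_cone R d d (nonbot L) L val \bot%O) => // q.
    by rewrite /(_ >=< _)%O le0x orbT.
  apply/idP/idP => [/eqP -> | ].
    by apply/imsetP => -[[x /= xb] _ bx]; rewrite bx eqxx in xb.
  apply: contraR => qb; apply/imsetP; exists (Sub q qb : nonbot L) => //.
split.
  rewrite (@chain_poly_prod_cone _ _ _ _ _ true); last by case=> [] [].
  (* [bool] has one minimal element below [true], so [n] is 0 here. *)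
  by rewrite card_bool LE; apply: only_real_roots_chain_op; rewrite -LE.
have M_real : only_real_roots (chain_poly R (nonbot L)).
  by apply: only_real_roots_dvd L_real; rewrite LE dvdp_mull.
have -> : chain_poly R (Prism L) =
    (1 + 'X) * chain_poly R (nonbot L *p nonbot L2)%type.
  apply: (@chain_poly_cone R _ _ (nonbot L *p nonbot L2)%type (Prism L)
    Some None) => // [[z|]|[z|]] //.
    by apply/esym/negbF; apply: imset_f.
  by apply/esym/imsetP => -[].
(* Without its minimum, [L2] is two atoms under [t]. *)
pose t : nonbot L2 := Sub ((true, true) : L2) isT.
rewrite (@chain_poly_prod_cone _ _ _ _ _ t); last by move=> [[[] []] ?] [[[] []] ?].
rewrite card_nonbot_L2; apply: only_real_roots_XD1M.
(* A factor [1 + 'X] needs an apex in [nonbot L]: the maximum of [L], unless [L] is a point and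
   [nonbot L] is empty. *)
have [bt|tb] := eqVneq (\top%O : L) \bot%O.
  have -> : chain_poly R (nonbot L) = 1.
    rewrite chain_polyE chain_poly_in_rec big_pred0 ?addr0 // => -[x xb].
    by case/eqP: xb; apply/eqP; rewrite -lex0 -bt lex1.
  rewrite derivC mulr0 addr0 => z.
  by rewrite rmorph1 (negPf (root1 z)).
pose m : nonbot L := Sub \top%O tb.
have ME : chain_poly R (nonbot L) = (1 + 'X) * chain_poly_in R [set~ m].
  rewrite chain_polyE -(setUCr [set m]) chain_poly_in_cone ?inE ?eqxx // => y _.
  by apply/orP; right; exact: lex1.
by rewrite ME; apply: only_real_roots_chain_op; rewrite -ME.
Qed.
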